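(* Let $W$ be a discrete memoryless channel with input alphabet $\mathcal X=\{1,\dots,J\}$ and output alphabet $\mathcal Y=\{1,\dots,K\}$, and let $q:\mathcal X\times\mathcal Y\to\mathbb R$ be a decoding metric. Then $$C_q(W)\le \bar R(W,q):=\max_{P_X}\ \min_{\substack{P_{Y\hat Y|X}\in\mathcal M_{\max}(q,P_X)\\ P_{Y|X}=W}} I(P_X,P_{\hat Y|X}),$$ where the maximum is over probability mass functions $P_X$ on $\mathcal X$, $P_{Y|X}$ and $P_{\hat Y|X}$ denote the two marginal conditional distributions of $P_{Y\hat Y|X}$, and $I(P_X,P_{\hat Y|X})$ is the mutual information between input and output when the input has law $P_X$ and the channel is $P_{\hat Y|X}$.
   Context: A DMC $W$ is a conditional pmf $W(k|j)$ on $\mathcal Y$ given $\mathcal X$, used as $W^n(\mathbf y|\mathbf x)=\prod_{i=1}^n W(y_i|x_i)$. For a codebook $\mathcal C_n=\{\mathbf x_1,\dots,\mathbf x_M\}\subset\mathcal X^n$, a message $m$ is chosen uniformly, $\mathbf x_m$ is sent, and the $q$-decoder outputs $\hat m=\arg\max_{m'} q^n(\mathbf x_{m'},\mathbf y)$ where $q^n(\mathbf x,\mathbf y)=\sum_{i=1}^n q(x_i,y_i)$ (an error occurs whenever some $\bar m\neq m$ has $q^n(\mathbf x_{\bar m},\mathbf y)\ge q^n(\mathbf x_m,\mathbf y)$). $P_e^q(\mathcal C_n,W)$ is the average error probability. A rate $R>0$ is achievable if for every $\epsilon>0$ there is a sequence of codebooks with $|\mathcal C_n|\ge 2^{n(R-\epsilon)}$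 and $\liminf_{n\to\infty} P_e^q(\mathcal C_n,W)=0$; the mismatch capacity $C_q(W)$ is the supremum of achievable rates. For a pmf $P_{X_1}$ on $\mathcal X$, $\mathcal M_{\max}(q,P_{X_1})$ is the set of all conditional pmfs $P_{Y\hat Y|X_1}$ on $\mathcal Y\times\mathcal Y$ given $\mathcal X$ such that, for every conditional pmf $P_{X_2|X_1\hat Y}$ on $\mathcal X$ given $\mathcal X\times\mathcal Y$ for which, under the joint law $P_{X_1}(x_1)P_{Y\hat Y|X_1}(y,\hat y|x_1)P_{X_2|X_1\hat Y}(x_2|x_1,\hat y)$ (so that $X_2-(X_1,\hat Y)-Y$ is a Markov chain), the marginals satisfy $P_{\hat Y X_2}=P_{\hat Y X_1}$, one has $\mathbb E[q(X_2,Y)]\ge \mathbb E[q(X_1,Y)]$. *)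

(* Defs.v *)
From mathcomp Require Import all_boot all_order all_algebra.
From mathcomp Require Import all_classical all_reals all_analysis.
Set Implicit Arguments. Unset Strict Implicit. Unset Printing Implicit Defensive.
Import Order.TTheory GRing.Theory Num.Theory.
Local Open Scope classical_set_scope.
Local Open Scope ring_scope.

Section Mismatch.
Variable R : realType.
Variables J K : nat.
Notation X := 'I_J.
Notation Y := 'I_K.

Definition is_pmf (T : finType) (p : T -> R) : Prop :=
  (forall t, 0 <= p t) /\ \sum_(t : T) p t = 1.

Definition is_cond_pmf (S T : finType) (W : S -> T -> R) : Prop :=
  forall s, is_pmf (W s).

Definition chan_n (W : X -> Y -> R) (n : nat)
  (x : {ffun 'I_n -> X}) (y : {ffun 'I_n -> Y}) : R :=
  \prod_(i < n) W (x i) (y i).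

Definition metric_n (q : X -> Y -> R) (n : nat)
  (x : {ffun 'I_n -> X}) (y : {ffun 'I_n -> Y}) : R :=
  \sum_(i < n) q (x i) (y i).

Definition codebook (n M : nat) := 'I_M -> {ffun 'I_n -> X}.

Definition err_prob (q : X -> Y -> R) (W : X -> Y -> R) (n M : nat)
  (C : codebook n M) : R :=
  M%:R^-1 * \sum_(m < M) \sum_(y : {ffun 'I_n -> Y})
     (if [exists m' : 'I_M, (m' != m) &&
            (metric_n q (C m) y <= metric_n q (C m') y)]
      then chan_n W (C m) y else 0).

Definition achievable (q : X -> Y -> R) (W : X -> Y -> R) (r : R) : Prop :=
  0 < r /\
  forall eps : R, 0 < eps ->
    exists (M : nat -> nat) (C : forall n, codebook n (M n)),
      (forall n, 2 `^ (n%:R * (r - eps)) <= (M n)%:R) /\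
      limn_inf (fun n => err_prob q W (C n)) = 0.

Definition mismatch_capacity (q : X -> Y -> R) (W : X -> Y -> R) : R :=
  sup [set r | achievable q W r].

(* P_{Y Yhat | X1} is represented as V : X -> Y * Y -> R, V x1 (y, yhat) *)
Definition M_max (q : X -> Y -> R) (P : X -> R) : set (X -> Y * Y -> R) :=
  [set V | is_cond_pmf V /\
    forall U : X -> Y -> X -> R,   (* U x1 yhat x2 = P_{X2|X1 Yhat} *)
      (forall x1 yh, is_pmf (U x1 yh)) ->
      (* P_{Yhat X2} = P_{Yhat X1} *)
      (forall (yh : Y) (x : X),
         \sum_(x1 : X) \sum_(y : Y) P x1 * V x1 (y, yh) * U x1 yh x
         = \sum_(y : Y) P x * V x (y, yh)) ->
      (* E[q(X2,Y)] >= E[q(X1,Y)] *)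
      \sum_(x1 : X) \sum_(y : Y) \sum_(yh : Y) \sum_(x2 : X)
          P x1 * V x1 (y, yh) * U x1 yh x2 * q x2 y
      >= \sum_(x1 : X) \sum_(y : Y) \sum_(yh : Y) P x1 * V x1 (y, yh) * q x1 y].

Definition margY (V : X -> Y * Y -> R) : X -> Y -> R :=
  fun x y => \sum_(yh : Y) V x (y, yh).
Definition margYhat (V : X -> Y * Y -> R) : X -> Y -> R :=
  fun x yh => \sum_(y : Y) V x (y, yh).

(* mutual information I(P_X, V) in bits, with 0 log 0 = 0 *)
Definition mutual_info (P : X -> R) (V : X -> Y -> R) : R :=
  \sum_(x : X) \sum_(y : Y)
    (if P x * V x y == 0 then 0
     else P x * V x y * (ln (V x y / \sum_(x' : X) P x' * V x' y) / ln 2)).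

Definition Rbar (W : X -> Y -> R) (q : X -> Y -> R) : R :=
  sup [set inf [set mutual_info P (margYhat V) |
                V in [set V | M_max q P V /\ margY V = W]]
      | P in [set P : X -> R | is_pmf P]].

End Mismatch.

(* Main.v *)
Require Import Defs.
From mathcomp Require Import all_boot all_order all_algebra.
From mathcomp Require Import finmap all_classical all_reals all_analysis.
From mathcomp Require Import ring lra.
Set Implicit Arguments. Unset Strict Implicit. Unset Printing Implicit Defensive.
Import Order.TTheory GRing.Theory Num.Theory.
Import numFieldNormedType.Exports.
Local Open Scope classical_set_scope.
Local Open Scope ring_scope.

(** Suppose [rho > Rbar W q].  For every input law [P] there is [V] in [M_max q P]
    with [Y]-marginal [W] and [I(P, margYhat V) < rho].  Take many codewords of
    composition close to [P] and send a random one, [x], through [V], with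
    outputs [y] and [yh].  The rate exceeds the information carried by [yh], so
    with probability at least 1/2 another codeword [x'] has the same joint type
    with [yh] as [x] has.  The joint type of [(x, yh, x')] is then a perturbation
    direction for the identity kernel that is admissible in the definition of
    [M_max], so given [x], [x'] and [yh] the metric difference of [x'] and [x]
    has nonnegative mean.  It is a sum of independent terms drawn from finitely
    many laws, so its kurtosis is bounded uniformly in the length and it is
    nonnegative with probability bounded below.  Compactness of the simplex
    makes the bound uniform in the composition. *)

(** * Finite probability *)

Lemma sum_delta (R : pzSemiRingType) (T : finType) (u : T) (F : T -> R) :
  \sum_t (u == t)%:R * F t = F u.
Proof.
rewrite (bigD1 u) //= eqxx mul1r big1 ?addr0 // => t /negbTE tu.
by rewrite eq_sym tu mul0r.
Qed.

Lemma term_le_sum (R : numDomainType) (T : finType) (F : T -> R) (t : T) :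
  (forall u, 0 <= F u) -> F t <= \sum_u F u.
Proof. by move=> F0; rewrite (bigD1 t) //= lerDl sumr_ge0. Qed.

Lemma exists_scale_le (R : realFieldType) (I : finType) (f g : I -> R) :
  (forall i, 0 <= g i) -> (forall i, g i = 0 -> f i <= 0) ->
  exists2 e, 0 < e & forall i, e * f i <= g i.
Proof.
move=> g0 fg; pose S := \sum_i `|f i / g i|.
have S0 : 0 <= S by apply: sumr_ge0.
have e0 : 0 < (1 + S)^-1 by rewrite invr_gt0 ltr_pwDl.
exists (1 + S)^-1 => // i; have [gi|gi] := eqVneq (g i) 0.
  by rewrite gi pmulr_rle0 ?fg.
have gi0 : 0 < g i by rewrite lt_def gi g0.
rewrite mulrC ler_pdivrMr ?ltr_pwDl // mulrC -ler_pdivrMr //.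
apply: le_trans (ler_norm _) (le_trans (_ : _ <= S) _); last by rewrite lerDr.
exact: (@term_le_sum _ _ (fun j => `|f j / g j|)).
Qed.

Section FinitePmf.
Variable R : realType.

Definition expect (T : finType) (p f : T -> R) : R := \sum_t p t * f t.

Definition prob (T : finType) (p : T -> R) (A : pred T) : R := \sum_(t | A t) p t.

Definition moment (T : finType) (p f : T -> R) (k : nat) : R :=
  expect p (fun t => f t ^+ k).

Lemma expectZ (T : finType) (p f : T -> R) (c : R) :
  expect p (fun t => c * f t) = c * expect p f.
Proof. by rewrite /expect mulr_sumr; apply: eq_bigr => t _; rewrite mulrCA. Qed.

Lemma probE (T : finType) (p : T -> R) (A : pred T) :
  prob p A = expect p (fun t => if A t then 1 else 0).
Proof.
by rewrite /prob big_mkcond; apply: eq_bigr => t _; case: ifP; rewrite ?mulr1 ?mulr0.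
Qed.

Section OneLaw.
Variables (T : finType) (p : T -> R).
Hypothesis p_pmf : is_pmf p.

Lemma pmf_ge0 t : 0 <= p t.
Proof. by have [+ _] := p_pmf; apply. Qed.

Lemma pmf_sum1 : \sum_t p t = 1.
Proof. by have [] := p_pmf. Qed.

Lemma expect_cst (c : R) : expect p (fun=> c) = c.
Proof. by rewrite /expect -mulr_suml pmf_sum1 mul1r. Qed.

Lemma expectB (f g : T -> R) : expect p (fun t => f t - g t) = expect p f - expect p g.
Proof. by rewrite /expect -sumrB; apply: eq_bigr => t _; rewrite mulrBr. Qed.

Lemma expect_centred (f : T -> R) : expect p (fun t => f t - expect p f) = 0.
Proof. by rewrite expectB expect_cst subrr. Qed.

Lemma expect_le (f g : T -> R) : (forall t, f t <= g t) -> expect p f <= expect p g.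
Proof. by move=> fg; apply: ler_sum => t _; rewrite ler_wpM2l ?pmf_ge0. Qed.

Lemma prob_mono (A B : pred T) : (forall t, A t -> B t) -> prob p A <= prob p B.
Proof.
move=> AB; rewrite /prob big_mkcond [leRHS]big_mkcond; apply: ler_sum => t _.
by case: ifPn => [/AB->|_] //; case: ifP => // _; exact: pmf_ge0.
Qed.

Lemma prob_le_add (A B C : pred T) :
  (forall t, A t -> B t || C t) -> prob p A <= prob p B + prob p C.
Proof.
move=> ABC; rewrite /prob (big_mkcond A) (big_mkcond B) (big_mkcond C) -big_split /=.
apply: ler_sum => t _; have := ABC t; have := pmf_ge0 t.
case: (A t) => [pt /(_ isT)|pt _]; last by rewrite addr_ge0 //; case: ifP.
by case: (B t) (C t) => [] [] //= _; rewrite ?addr0 ?add0r ?lerDl.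
Qed.

Lemma prob_ge0 (A : pred T) : 0 <= prob p A.
Proof. by apply: sumr_ge0 => t _; exact: pmf_ge0. Qed.

Lemma prob_le1 (A : pred T) : prob p A <= 1.
Proof. by rewrite -pmf_sum1; exact: (@prob_mono A predT). Qed.

Lemma prob_compl (A : pred T) : prob p A = 1 - prob p (predC A).
Proof. by rewrite -pmf_sum1 (bigID A) /= addrK. Qed.

Lemma moment0 (f : T -> R) : moment p f 0 = 1.
Proof. exact: expect_cst. Qed.

Lemma moment_even_ge0 (f : T -> R) (k : nat) : 0 <= moment p f k.*2.
Proof.
by apply: sumr_ge0 => t _; rewrite mulr_ge0 ?pmf_ge0 // -muln2 exprM sqr_ge0.
Qed.

Lemma moment2_eq0 (f : T -> R) : moment p f 2 = 0 -> forall t, p t = 0 \/ f t = 0.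
Proof.
move=> /psumr_eq0P terms0 t.
have /eqP := terms0 (fun t _ => mulr_ge0 (pmf_ge0 t) (sqr_ge0 _)) t isT.
by rewrite mulf_eq0 sqrf_eq0 => /orP[/eqP|/eqP]; [left|right].
Qed.

Lemma chebyshev (f : T -> R) (tau : R) :
  0 < tau -> prob p (fun t => tau < f t) <= moment p f 2 / tau ^+ 2.
Proof.
move=> tau0; rewrite /prob big_mkcond /moment /expect mulr_suml.
apply: ler_sum => t _; case: ifPn => [ft|_]; last first.
  by rewrite divr_ge0 ?sqr_ge0 // mulr_ge0 ?sqr_ge0 ?pmf_ge0.
rewrite ler_pdivlMr ?exprn_gt0 // ler_wpM2l ?pmf_ge0 //.
by rewrite ler_sqr ?nnegrE ltW // (lt_trans tau0).
Qed.

End OneLaw.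

(** * Centred variables of bounded kurtosis *)

Definition centred_kurtosis_le (T : finType) (p f : T -> R) (kappa : R) : Prop :=
  expect p f = 0 /\ moment p f 4 <= kappa * moment p f 2 ^+ 2.

Lemma normalized_quartic_le_indicator (kappa u : R) : 1 <= kappa ->
  4 * kappa ^+ 2 * u + 2 * kappa * u ^+ 2 - u ^+ 4 <= 6 * kappa ^+ 4 * (if 0 <= u then 1 else 0).
Proof.
move=> k1; have [u0|u0] := leP 0 u.
  have : 0 <= (u ^+ 2 - (kappa ^+ 2 + kappa)) ^+ 2 by exact: sqr_ge0.
  have : 0 <= kappa ^+ 2 * (u - 1) ^+ 2 by rewrite mulr_ge0 ?sqr_ge0.
  have k12 : kappa <= kappa ^+ 2 by rewrite expr2 ler_peMr //; lra.
  have k24 : kappa ^+ 2 <= kappa ^+ 4.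
    by rewrite (exprM kappa 2 2) [leRHS]expr2 ler_peMr ?sqr_ge0 //; lra.
  have k34 : kappa ^+ 3 <= kappa ^+ 4.
    by rewrite (exprS kappa 3) ler_peMl // exprn_ge0; lra.
  by rewrite mulr1; lra.
rewrite mulr0.
have -> : 4 * kappa ^+ 2 * u + 2 * kappa * u ^+ 2 - u ^+ 4 =
  u * (4 * kappa ^+ 2 + 2 * kappa * u - u ^+ 3) by ring.
rewrite nmulr_rle0 //; have [uk|uk] := leP (- (2 * kappa)) u.
  by have : u ^+ 3 <= 0; [rewrite exprn_odd_le0 // ltW|nra].
have u2 : 2 * kappa <= u ^+ 2 by nra.
have : u ^+ 3 <= 2 * kappa * u by rewrite exprSr ler_wnM2r // ltW.
by have := sqr_ge0 kappa; lra.
Qed.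

(* The mean of the left-hand side only involves the first, second and fourth moments. *)
Lemma quartic_le_indicator (kappa s u : R) : 1 <= kappa -> 0 < s ->
  4 * kappa ^+ 2 * s ^+ 3 * u + 2 * kappa * s ^+ 2 * u ^+ 2 - u ^+ 4 <=
  6 * kappa ^+ 4 * s ^+ 4 * (if 0 <= u then 1 else 0).
Proof.
move=> k1 s0; have -> : u = u / s * s by rewrite divfK // gt_eqF.
rewrite pmulr_lge0 //; move: (u / s) => v.
rewrite [6 * _ * s ^+ 4]mulrC -[leRHS]mulrA.
rewrite [leLHS](_ : _ = s ^+ 4 * (4 * kappa ^+ 2 * v + 2 * kappa * v ^+ 2 - v ^+ 4)).
  by rewrite ler_pM2l ?exprn_gt0 // normalized_quartic_le_indicator.
by ring.
Qed.

Lemma expect_quartic (T : finType) (p f : T -> R) (a b : R) :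
  expect p (fun t => a * f t + b * f t ^+ 2 - f t ^+ 4) =
  a * expect p f + b * moment p f 2 - moment p f 4.
Proof.
rewrite /moment /expect !mulr_sumr -sumrN -!big_split /=.
by apply: eq_bigr => t _; ring.
Qed.

Lemma prob_nonneg_moment2_eq0 (T : finType) (p f : T -> R) :
  is_pmf p -> moment p f 2 = 0 -> prob p (fun t => 0 <= f t) = 1.
Proof.
move=> pP f2; rewrite -(pmf_sum1 pP) /prob big_mkcond; apply: eq_bigr => t _.
by have [->|->] := moment2_eq0 pP f2 t; rewrite ?lexx ?if_same.
Qed.

Lemma centred_kurtosis_prob_nonneg (T : finType) (p f : T -> R) (kappa : R) :
  is_pmf p -> 1 <= kappa -> centred_kurtosis_le p f kappa ->
  (6 * kappa ^+ 3)^-1 <= prob p (fun t => 0 <= f t).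
Proof.
move=> pP k1 [f1 f4]; have k3 := exprn_ege1 3 k1.
have [f2|f2] := eqVneq (moment p f 2) 0.
  by rewrite prob_nonneg_moment2_eq0 // invf_le1; lra.
have v0 : 0 < moment p f 2 by rewrite lt_def f2 (moment_even_ge0 pP f 1).
pose s := Num.sqrt (moment p f 2); have s0 : 0 < s by rewrite sqrtr_gt0.
have sv : s ^+ 2 = moment p f 2 by rewrite sqr_sqrtr // ltW.
have : 2 * kappa * s ^+ 2 * moment p f 2 - moment p f 4 <=
    6 * kappa ^+ 4 * s ^+ 4 * prob p (fun t => 0 <= f t).
  have := expect_quartic p f (4 * kappa ^+ 2 * s ^+ 3) (2 * kappa * s ^+ 2).
  rewrite f1 mulr0 add0r => <-; rewrite probE -expectZ.
  by apply: expect_le => // t; exact: quartic_le_indicator.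
have s4 : 0 < kappa * s ^+ 4 by rewrite mulr_gt0 ?exprn_gt0 //; lra.
rewrite -sv (_ : 6 * _ * _ * _ =
  kappa * s ^+ 4 * (6 * kappa ^+ 3 * prob p (fun t => 0 <= f t))); last by ring.
move=> mean_le; rewrite -[leLHS]mulr1 ler_pdivrMl; last by lra.
by rewrite -(ler_pM2l s4); apply: le_trans mean_le; rewrite -sv in f4; lra.
Qed.

Section IndependentPair.
Variables (S T : finType) (p f : S -> R) (r g : T -> R).

Definition pair_law (st : S * T) : R := p st.1 * r st.2.

Lemma moment_pair_law (k : nat) :
  moment pair_law (fun st => f st.1 + g st.2) k =
  \sum_(j < k.+1) moment p f (k - j) * moment r g j *+ 'C(k, j).
Proof.
transitivity (\sum_s \sum_t \sum_(j < k.+1)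
    p s * f s ^+ (k - j) * (r t * g t ^+ j) *+ 'C(k, j)).
  rewrite pair_bigA /=; apply: eq_bigr => -[s t] _ /=.
  rewrite exprDn mulr_sumr; apply: eq_bigr => j _; rewrite /pair_law /= mulrnAr.
  by congr (_ *+ _); ring.
under eq_bigr do rewrite exchange_big /=.
rewrite exchange_big /=; apply: eq_bigr => j _.
under eq_bigr do rewrite sumrMnl -mulr_sumr.
by rewrite sumrMnl -mulr_suml.
Qed.

Hypotheses (p_pmf : is_pmf p) (r_pmf : is_pmf r).

Lemma expect_pair_law :
  expect pair_law (fun st => f st.1 + g st.2) = expect p f + expect r g.
Proof.
have := moment_pair_law 1; rewrite !big_ord_recr big_ord0 /= add0r !mulr1n.
by rewrite (moment0 p_pmf) (moment0 r_pmf) mulr1 mul1r.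
Qed.

Lemma moment2_pair_law : expect p f = 0 ->
  moment pair_law (fun st => f st.1 + g st.2) 2 = moment p f 2 + moment r g 2.
Proof.
move=> f1; rewrite moment_pair_law !big_ord_recr big_ord0 /= add0r !mulr1n.
by rewrite (moment0 p_pmf) (moment0 r_pmf) mulr1 mul1r [moment p f (2 - 1)]f1 mul0r mul0rn addr0.
Qed.

Lemma moment4_pair_law : expect p f = 0 -> expect r g = 0 ->
  moment pair_law (fun st => f st.1 + g st.2) 4 =
  moment p f 4 + 6 * (moment p f 2 * moment r g 2) + moment r g 4.
Proof.
move=> f1 g1; rewrite moment_pair_law !big_ord_recr big_ord0 /= add0r !mulr1n.
rewrite (moment0 p_pmf) (moment0 r_pmf) [moment p f (4 - 3)]f1 [moment r g 1]g1.
by rewrite mulr1 mul1r mulr0 mul0r !mul0rn !addr0 mulr_natl.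
Qed.

(* [3 <= kappa] absorbs the cross term [6 * E f^2 * E g^2] of the fourth moment. *)
Lemma centred_kurtosis_pair_law (kappa : R) : 3 <= kappa ->
  centred_kurtosis_le p f kappa -> centred_kurtosis_le r g kappa ->
  centred_kurtosis_le pair_law (fun st => f st.1 + g st.2) kappa.
Proof.
move=> k3 [f1 f4] [g1 g4]; split; first by rewrite expect_pair_law f1 g1 addr0.
rewrite moment2_pair_law // moment4_pair_law //.
have := mulr_ge0 (moment_even_ge0 p_pmf f 1) (moment_even_ge0 r_pmf g 1).
by rewrite /=; nra.
Qed.

End IndependentPair.

(** * Product laws *)

Definition prod_law (I T : finType) (w : I -> T -> R) (f : {ffun I -> T}) : R :=
  \prod_i w i (f i).

Definition coord_sum (I T : finType) (z : I -> T -> R) (f : {ffun I -> T}) : R :=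
  \sum_i z i (f i).

Lemma prod_law_pmf (I T : finType) (w : I -> T -> R) :
  is_cond_pmf w -> is_pmf (prod_law w).
Proof.
move=> wP; split=> [f|]; first by apply: prodr_ge0 => i _; exact: pmf_ge0.
by rewrite -(bigA_distr_bigA w) big1 // => i _; exact: pmf_sum1.
Qed.

Definition ffun_cons (T : finType) (n : nat) (ag : T * {ffun 'I_n -> T}) :
  {ffun 'I_n.+1 -> T} := [ffun i => if unlift ord0 i is Some j then ag.2 j else ag.1].

Lemma ffun_cons_bij (T : finType) (n : nat) : bijective (@ffun_cons T n).
Proof.
exists (fun f : {ffun 'I_n.+1 -> T} => (f ord0, [ffun i : 'I_n => f (lift ord0 i)]))
  => [[a g]|f].
  rewrite ffunE unlift_none; congr pair; apply/ffunP => i.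
  by rewrite !ffunE liftK.
by apply/ffunP => i; rewrite ffunE; case: unliftP => [j ->|->]; rewrite ?ffunE.
Qed.

Lemma moment_prod_lawS (T : finType) (n : nat) (w z : 'I_n.+1 -> T -> R) (k : nat) :
  moment (prod_law w) (coord_sum z) k =
  moment (pair_law (w ord0) (prod_law (fun i => w (lift ord0 i))))
    (fun ag => z ord0 ag.1 + coord_sum (fun i => z (lift ord0 i)) ag.2) k.
Proof.
rewrite /moment /expect (reindex (@ffun_cons T n)) /=; last first.
  exact/onW_bij/ffun_cons_bij.
apply: eq_bigr => -[a g] _; rewrite /prod_law /coord_sum !big_ord_recl /=.
rewrite /pair_law /= ffunE unlift_none; congr (_ * _ * (_ + _) ^+ _).
  by apply: eq_bigr => i _; rewrite ffunE liftK.
by apply: eq_bigr => i _; rewrite ffunE liftK.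
Qed.

Lemma moment_prod_law0 (T : finType) (w z : 'I_0 -> T -> R) (k : nat) :
  moment (prod_law w) (coord_sum z) k.+1 = 0.
Proof. by apply: big1 => f _; rewrite /coord_sum big_ord0 expr0n mulr0. Qed.

Lemma moment2_prod_law (T : finType) (n : nat) (w z : 'I_n -> T -> R) :
  is_cond_pmf w -> (forall i, expect (w i) (z i) = 0) ->
  moment (prod_law w) (coord_sum z) 2 = \sum_i moment (w i) (z i) 2.
Proof.
elim: n w z => [|n IH] w z wP z0; first by rewrite big_ord0 moment_prod_law0.
rewrite moment_prod_lawS moment2_pair_law //; last exact: prod_law_pmf.
by rewrite big_ord_recl IH.
Qed.

Lemma chebyshev_prod_law (T : finType) (n : nat) (w z : 'I_n -> T -> R) (tau B : R) :
  0 < tau -> is_cond_pmf w -> (forall i, expect (w i) (z i) = 0) ->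
  (forall i, moment (w i) (z i) 2 <= B) ->
  prob (prod_law w) (fun f => tau < coord_sum z f) <= n%:R * B / tau ^+ 2.
Proof.
move=> tau0 wP z0 zB; apply: le_trans (chebyshev (prod_law_pmf wP) _ tau0) _.
rewrite ler_pM2r ?invr_gt0 ?exprn_gt0 // moment2_prod_law //.
by rewrite -[n in leRHS]card_ord mulr_natl -sumr_const; exact: ler_sum.
Qed.

Lemma centred_kurtosis_prod_law (T : finType) (n : nat) (w z : 'I_n -> T -> R) (kappa : R) :
  3 <= kappa -> is_cond_pmf w -> (forall i, centred_kurtosis_le (w i) (z i) kappa) ->
  centred_kurtosis_le (prod_law w) (coord_sum z) kappa.
Proof.
move=> k3; elim: n w z => [|n IH] w z wP zk.
  split; first exact: (moment_prod_law0 w z 0).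
  by rewrite !moment_prod_law0 expr0n mulr0.
rewrite /centred_kurtosis_le -[expect _ _]/(moment _ _ 1) !moment_prod_lawS.
have wP' : is_cond_pmf (fun i => w (lift ord0 i)) by move=> i; exact: wP.
by apply: centred_kurtosis_pair_law => //; [exact: prod_law_pmf|exact: IH].
Qed.

(** * Sums drawn from finitely many laws *)

Lemma exists_kurtosis_bound (I T : finType) (p X : I -> T -> R) :
  is_cond_pmf p -> (forall i, expect (p i) (X i) = 0) ->
  exists2 kappa, 3 <= kappa & forall i, centred_kurtosis_le (p i) (X i) kappa.
Proof.
move=> pP X0.
have [i|i /eqP|e e0 e_le] := @exists_scale_le R I (fun i => moment (p i) (X i) 4)
  (fun i => moment (p i) (X i) 2 ^+ 2).
- exact: sqr_ge0.
- rewrite sqrf_eq0 => /eqP/moment2_eq0 - /(_ (pP i)) pX.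
  rewrite /moment /expect big1 // => t _.
  by have [->|->] := pX t; rewrite ?mul0r // expr0n mulr0.
exists (3 + e^-1); first by rewrite lerDl invr_ge0 ltW.
move=> i; split=> //; apply: le_trans (_ : e^-1 * moment (p i) (X i) 2 ^+ 2 <= _).
  by rewrite mulrC ler_pdivlMr // mulrC.
by rewrite ler_wpM2r ?sqr_ge0 // lerDr.
Qed.

Lemma sum_nonneg_prob_lbound (I T : finType) (p X : I -> T -> R) :
  is_cond_pmf p ->
  exists2 c, 0 < c & forall (n : nat) (s : 'I_n -> I),
    0 <= \sum_i expect (p (s i)) (X (s i)) ->
    c <= prob (prod_law (fun i => p (s i))) (fun f => 0 <= coord_sum (fun i => X (s i)) f).
Proof.
move=> pP; pose Z i t := X i t - expect (p i) (X i).
have [kappa k3 kZ] := @exists_kurtosis_bound _ _ p Z pP (fun i => expect_centred (pP i) _).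
have k0 : 0 < kappa by lra.
exists (6 * kappa ^+ 3)^-1; first by rewrite invr_gt0 mulr_gt0 ?exprn_gt0.
move=> n s mean0; have sP : is_cond_pmf (fun i => p (s i)) by move=> i; exact: pP.
have k1 : 1 <= kappa by lra.
apply: le_trans (centred_kurtosis_prob_nonneg (prod_law_pmf sP) k1
  (centred_kurtosis_prod_law k3 sP (fun i => kZ (s i)))) _.
apply: prob_mono => [|f Z0]; first exact: prod_law_pmf.
move: (addr_ge0 Z0 mean0); rewrite -big_split /=.
by under eq_bigr do rewrite subrK.
Qed.

End FinitePmf.

(** * Metric differences under a maximal channel *)

Lemma perturbed_identity_kernel (R : realType) (S T : finType) (p : S -> T -> R)
    (D : S -> T -> S -> R) :
  (forall a b, 0 <= p a b) -> (forall a b c, a != c -> 0 <= D a b c) ->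
  (forall a b c, a != c -> p a b = 0 -> D a b c = 0) -> (forall a b, \sum_c D a b c = 0) ->
  exists U e, [/\ 0 < e, forall a b, is_pmf (U a b) &
    forall a b c, p a b * U a b c = (a == c)%:R * p a b + e * D a b c].
Proof.
move=> p0 D_ge0 D_supp D_row.
have {}D_supp a b c : p a b = 0 -> D a b c = 0.
  move=> pab; have [<-|/D_supp->//] := eqVneq a c.
  rewrite -[RHS](D_row a b) (bigD1 a) //= big1 ?addr0 // => d.
  by rewrite eq_sym => /D_supp->.
have [ab|ab pab|e e0 e_le] := @exists_scale_le R (S * T)%type
  (fun ab => - D ab.1 ab.2 ab.1) (fun ab => p ab.1 ab.2); first exact: p0.
  by rewrite D_supp // oppr0.
(* Where [p a b = 0] the division gives [0] and the kernel is the identity. *)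
exists (fun a b c => (a == c)%:R + e * (D a b c / p a b)), e; split=> // [a b|a b c].
  split=> [c|]; last first.
    rewrite big_split /= -mulr_sumr -mulr_suml D_row mul0r mulr0 addr0.
    by rewrite -[RHS](sum_delta a (fun=> 1)); apply: eq_bigr => c _; rewrite mulr1.
  case: eqVneq => [<-|ac]; last first.
    by rewrite add0r mulr_ge0 ?(ltW e0) // divr_ge0 ?D_ge0.
  have [->|pab] := eqVneq (p a b) 0; first by rewrite invr0 mulr0 mulr0 addr0.
  have pab0 : 0 < p a b by rewrite lt_def pab p0.
  by rewrite mulrA -lerBlDl sub0r ler_pdivlMr // mulN1r lerNl -mulrN (e_le (a, b)).
have [pab|pab] := eqVneq (p a b) 0; last by field.
by rewrite D_supp // pab; ring.
Qed.

Section MaximalChannel.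
Variables (R : realType) (J K : nat).
Variables (q : 'I_J -> 'I_K -> R) (V : 'I_J -> 'I_K * 'I_K -> R).
Hypothesis V_pmf : is_cond_pmf V.

Lemma margYhat_pmf : is_cond_pmf (margYhat V).
Proof.
move=> a; split=> [b|]; first by apply: sumr_ge0 => y _; exact: pmf_ge0.
rewrite -(pmf_sum1 (V_pmf a)) exchange_big /= pair_bigA /=.
by apply: eq_bigr => -[].
Qed.

Definition posterior (a : 'I_J) (b y : 'I_K) : R := V a (y, b) / margYhat V a b.

Lemma posteriorK a b y : posterior a b y * margYhat V a b = V a (y, b).
Proof.
have [m0|m0] := eqVneq (margYhat V a b) 0; last by rewrite divfK.
by rewrite m0 mulr0 (psumr_eq0P (fun y _ => pmf_ge0 (V_pmf a) (y, b)) m0).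
Qed.

Lemma posterior_pmf a b : 0 < margYhat V a b -> is_pmf (posterior a b).
Proof.
move=> mab; split=> [y|]; first by rewrite divr_ge0 ?(ltW mab) ?(pmf_ge0 (V_pmf a)).
by rewrite -mulr_suml divff // gt_eqF.
Qed.

Definition drift (a : 'I_J) (b : 'I_K) (c : 'I_J) : R :=
  expect (posterior a b) (fun y => q c y - q a y).

Lemma drift_diag a b : drift a b a = 0.
Proof. by apply: big1 => y _; rewrite subrr mulr0. Qed.

Lemma margYhat_drift a b c :
  margYhat V a b * drift a b c = \sum_y V a (y, b) * (q c y - q a y).
Proof. by rewrite mulr_sumr; apply: eq_bigr => y _; rewrite -posteriorK; ring. Qed.

Lemma overtaking_prob_lbound :
  exists2 c, 0 < c & forall n (x x' : {ffun 'I_n -> 'I_J}) (yh : {ffun 'I_n -> 'I_K}),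
    (forall i, 0 < margYhat V (x i) (yh i)) ->
    0 <= \sum_i drift (x i) (yh i) (x' i) ->
    c <= prob (prod_law (fun i => posterior (x i) (yh i)))
           (fun y => metric_n q x y <= metric_n q x' y).
Proof.
pose I := {abc : 'I_J * 'I_K * 'I_J | 0 < margYhat V abc.1.1 abc.1.2}.
pose p (t : I) := posterior (val t).1.1 (val t).1.2.
pose X (t : I) y := q (val t).2 y - q (val t).1.1 y.
have pP : is_cond_pmf p by move=> t; exact: posterior_pmf (valP t).
have [c c0 sum_ge] := sum_nonneg_prob_lbound X pP.
exists c => // n x x' yh pos mean0.
have := sum_ge n (fun i => exist _ (x i, yh i, x' i) (pos i)) mean0.
rewrite /prob (eq_bigl (fun y : {ffun 'I_n -> 'I_K} => metric_n q x y <= metric_n q x' y)) //.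
by move=> y; rewrite /coord_sum sumrB subr_ge0.
Qed.

Variable P : 'I_J -> R.

Lemma expected_metric_gain (U : 'I_J -> 'I_K -> 'I_J -> R) :
  (forall a b, is_pmf (U a b)) ->
  \sum_a \sum_y \sum_b \sum_c P a * V a (y, b) * U a b c * q c y -
    \sum_a \sum_y \sum_b P a * V a (y, b) * q a y =
  \sum_a \sum_b \sum_c P a * margYhat V a b * U a b c * drift a b c.
Proof.
move=> UP; rewrite -sumrB; apply: eq_bigr => a _; rewrite -sumrB.
transitivity (\sum_y \sum_b \sum_c P a * V a (y, b) * U a b c * (q c y - q a y)).
  apply: eq_bigr => y _; rewrite -sumrB; apply: eq_bigr => b _.
  rewrite -[X in _ - X]mulr1 -(pmf_sum1 (UP a b)) mulr_sumr -sumrB.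
  by apply: eq_bigr => c _; ring.
rewrite exchange_big; apply: eq_bigr => b _.
rewrite exchange_big; apply: eq_bigr => c _.
rewrite mulrAC -[P a * _ * _]mulrA margYhat_drift mulr_sumr mulr_suml.
by apply: eq_bigr => y _; ring.
Qed.

Hypotheses (P_pmf : is_pmf P) (V_max : M_max q P V).

Lemma M_max_direction_ge0 (T : 'I_J -> 'I_K -> 'I_J -> R) :
  (forall a b c, a != c -> 0 <= T a b c) ->
  (forall a b c, a != c -> P a * margYhat V a b = 0 -> T a b c = 0) ->
  (forall a b, \sum_c T a b c = 0) -> (forall b c, \sum_a T a b c = 0) ->
  0 <= \sum_a \sum_b \sum_c T a b c * drift a b c.
Proof.
move=> T_ge0 T_supp T_row T_col; pose p a b := P a * margYhat V a b.
have p0 a b : 0 <= p a b by rewrite mulr_ge0 ?(pmf_ge0 P_pmf) ?(pmf_ge0 (margYhat_pmf a)).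
have [U [e [e0 U_pmf pU]]] := perturbed_identity_kernel p0 T_ge0 T_supp T_row.
have [_ qU] := V_max.
have gain : \sum_a \sum_b \sum_c p a b * U a b c * drift a b c =
    e * \sum_a \sum_b \sum_c T a b c * drift a b c.
  rewrite mulr_sumr; apply: eq_bigr => a _; rewrite mulr_sumr; apply: eq_bigr => b _.
  rewrite mulr_sumr; apply: eq_bigr => c _; rewrite pU mulrDl.
  have [->|_] := eqVneq a c; last by rewrite !mul0r add0r mulrA.
  by rewrite drift_diag !mulr0 addr0.
rewrite -(pmulr_rge0 _ e0) -gain -expected_metric_gain // subr_ge0; apply: qU => // b c.
transitivity (\sum_a p a b * U a b c).
  by apply: eq_bigr => a _; rewrite -mulr_suml -mulr_sumr.
under eq_bigr do rewrite pU eq_sym.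
by rewrite big_split /= sum_delta -mulr_sumr T_col mulr0 addr0 -[RHS]mulr_sumr.
Qed.

End MaximalChannel.

(** * Empirical counts *)

Definition occ (I T : finType) (g : I -> T) (t : T) : nat :=
  (\sum_i (g i == t))%N.

Lemma occ_le_card (I T : finType) (g : I -> T) (t : T) : (occ g t <= #|I|)%N.
Proof. by rewrite -sum1_card; apply: leq_sum => i _; exact: leq_b1. Qed.

Lemma sum_occ (R : pzSemiRingType) (I T : finType) (g : I -> T) (F : T -> R) :
  \sum_t (occ g t)%:R * F t = \sum_i F (g i).
Proof.
under eq_bigr do rewrite natr_sum mulr_suml.
by rewrite exchange_big; apply: eq_bigr => i _ /=; rewrite sum_delta.
Qed.

Lemma sum_occ_pair (I S T : finType) (g : I -> S) (h : I -> T) (s : S) :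
  (\sum_t occ (fun i => (g i, h i)) (s, t) = occ g s)%N.
Proof.
rewrite exchange_big; apply: eq_bigr => i _; rewrite (bigD1 (h i)) //= big1 => [|t].
  by rewrite addn0 xpair_eqE eqxx andbT.
by rewrite eq_sym xpair_eqE => /negbTE->; rewrite andbF.
Qed.

Lemma M_max_drift_ge0 (R : realType) (J K n : nat) (q : 'I_J -> 'I_K -> R)
    (P : 'I_J -> R) (V : 'I_J -> 'I_K * 'I_K -> R)
    (x x' : {ffun 'I_n -> 'I_J}) (yh : {ffun 'I_n -> 'I_K}) :
  is_pmf P -> M_max q P V ->
  (forall i, 0 < margYhat V (x i) (yh i)) ->
  (forall i, P (x i) = 0 -> x i = x' i) ->
  occ (fun i => (x i, yh i)) =1 occ (fun i => (x' i, yh i)) ->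
  0 <= \sum_i drift q V (x i) (yh i) (x' i).
Proof.
move=> P_pmf V_max pos rare same_type; have V_pmf : is_cond_pmf V by case: V_max.
pose N a b c : R := (occ (fun i => (x i, yh i, x' i)) (a, b, c))%:R.
have N_row a b : \sum_c N a b c = (occ (fun i => (x i, yh i)) (a, b))%:R.
  by rewrite -natr_sum sum_occ_pair.
have N_col b c : \sum_a N a b c = (occ (fun i => (x' i, yh i)) (c, b))%:R.
  rewrite -(sum_occ_pair _ x) natr_sum; apply: eq_bigr => a _.
  congr _%:R; apply: eq_bigr => i _.
  by rewrite !xpair_eqE andbC [(x i == a) && _]andbC andbA.
pose T a b c := N a b c - (a == c)%:R * \sum_d N a b d.
have TN a b c : a != c -> T a b c = N a b c.
  by rewrite /T => /negbTE->; rewrite mul0r subr0.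
have -> : \sum_i drift q V (x i) (yh i) (x' i) =
    \sum_a \sum_b \sum_c T a b c * drift q V a b c.
  rewrite -(sum_occ (fun i => (x i, yh i, x' i))
    (fun abc => drift q V abc.1.1 abc.1.2 abc.2)) !pair_bigA /=.
  apply: eq_bigr => -[[a b] c] _ /=.
  have [<-|ac] := eqVneq a c; first by rewrite drift_diag !mulr0.
  by rewrite TN.
apply: (M_max_direction_ge0 V_pmf P_pmf V_max) => [a b c ac|a b c ac pab|a b|b c].
- by rewrite TN.
- rewrite TN // /N [occ _ _]big1 // => i _; case: eqP => //= -[xa yb xc].
  move/eqP: pab; rewrite mulf_eq0 -xa -yb (gt_eqF (pos i)) orbF => /eqP/rare.
  by rewrite xa xc => /eqP; rewrite (negbTE ac).
- by rewrite sumrB sum_delta subrr.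
- under eq_bigr do rewrite /T eq_sym.
  by rewrite sumrB sum_delta N_col N_row same_type subrr.
Qed.

(** * Typical inputs *)

Definition typical {R : realType} {S : finType} {n : nat} (P : S -> R) (eta : R)
    (x : {ffun 'I_n -> S}) : bool :=
  [forall s, `|(occ x s)%:R - n%:R * P s| <= n%:R * eta].

Section TypicalInputs.
Variables (R : realType) (S T : finType) (P : S -> R).

Lemma typical_sum_le n (x : {ffun 'I_n -> S}) (eta : R) (F : S -> R) :
  typical P eta x -> \sum_i F (x i) <= n%:R * (expect P F + eta * \sum_s `|F s|).
Proof.
move=> /forallP xP; rewrite -sum_occ /expect mulr_sumr -big_split /= mulr_sumr.
apply: ler_sum => s _; rewrite mulrDr -lerBlDl !mulrA -mulrBl.
by apply: le_trans (ler_norm _) _; rewrite normrM ler_wpM2r.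
Qed.

Lemma typical_wlln (U h : S -> T -> R) (delta eps : R) :
  is_cond_pmf U -> 0 < delta -> 0 < eps ->
  exists2 eta, 0 < eta & \forall n \near \oo, forall x : {ffun 'I_n -> S},
    typical P eta x ->
    prob (prod_law (fun i => U (x i)))
      (fun y => n%:R * (expect P (fun s => expect (U s) (h s)) + delta) <
                coord_sum (fun i => h (x i)) y) <= eps.
Proof.
move=> UP delta0 eps0; pose D s := expect (U s) (h s).
pose var s := moment (U s) (fun t => h s t - D s) 2; pose B := \sum_s var s.
have var0 s : 0 <= var s by exact: (moment_even_ge0 (UP s) _ 1).
pose eta := delta / 2 / (1 + \sum_s `|D s|).
have D0 : 0 < 1 + \sum_s `|D s| by rewrite ltr_pwDl // sumr_ge0.
exists eta; first by rewrite !divr_gt0.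
near=> n; move=> x xP; have n0 : 0 < n%:R :> R.
  by rewrite ltr0n; near: n; exact: nbhs_infty_gt.
have etaD : eta * \sum_s `|D s| <= delta / 2.
  by rewrite mulrAC ler_pdivrMr // ler_pM2l ?divr_gt0 // lerDr.
have gap0 : 0 < n%:R * (delta / 2) by rewrite mulr_gt0 ?divr_gt0.
have UxP : is_cond_pmf (fun i => U (x i)) by move=> i; exact: UP.
apply: le_trans (_ : prob _ (fun y => n%:R * (delta / 2) <
    coord_sum (fun i t => h (x i) t - D (x i)) y) <= _).
  apply: prob_mono => [|y y_high]; first exact: prod_law_pmf.
  rewrite /coord_sum sumrB; have := typical_sum_le D xP.
  have := ler_wpM2l (ltW n0) etaD; move: y_high; rewrite /coord_sum !mulrDr /D; lra.
apply: le_trans (@chebyshev_prod_law _ _ _ _ _ _ B gap0 UxP _ _) _ => [i|i|].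
- exact: expect_centred.
- exact: term_le_sum.
have : B / (eps * (delta / 2) ^+ 2) <= n%:R by near: n; exact: nbhs_infty_ger.
rewrite !ler_pdivrMr ?mulr_gt0 ?exprn_gt0 ?divr_gt0 // => nB.
rewrite (_ : _ * _ ^+ 2 = n%:R * (n%:R * (eps * (delta / 2) ^+ 2))); last by ring.
by rewrite ler_pM2l.
Unshelve. all: by end_near.
Qed.

End TypicalInputs.

Lemma poly_le_expR_near (R : realType) (d : nat) (c tau : R) :
  0 <= c -> 0 < tau -> \forall n \near \oo, c * n.+1%:R ^+ d <= expR (n%:R * tau).
Proof.
move=> c0 tau0; near=> n.
have n0 : (0 < n)%N by near: n; exact: nbhs_infty_gt.
apply: le_trans (_ : c * (2 * n%:R) ^+ d <= _).
  rewrite ler_wpM2l // lerXn2r ?nnegrE ?mulr_ge0 //.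
  by rewrite -natrM ler_nat mul2n -addnn -addn1 leq_add2l.
apply: le_trans (le_trans (_ : _ <= (n%:R * tau) ^+ d.+1 / d.+1`!%:R) _)
  (expR_ge1Dxn d (mulr_ge0 (ler0n _ n) (ltW tau0))); last by rewrite lerDr.
rewrite ler_pdivlMr ?ltr0n ?fact_gt0 // !exprMn exprS.
have : c * 2 ^+ d * d.+1`!%:R / tau ^+ d.+1 <= n%:R by near: n; exact: nbhs_infty_ger.
rewrite ler_pdivrMr ?exprn_gt0 // => /(ler_wpM2l (exprn_ge0 d (ler0n R n))).
by lra.
Unshelve. all: by end_near.
Qed.

(** * Information density *)

Definition kl_div {R : realType} {T : finType} (p r : T -> R) : R :=
  expect p (fun t => ln (p t / r t)).

Lemma kl_div_ge0 (R : realType) (T : finType) (p r : T -> R) :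
  is_pmf p -> is_pmf r -> (forall t, r t = 0 -> p t = 0) -> 0 <= kl_div p r.
Proof.
move=> pP rP abs_cont.
rewrite -(subrr 1) -{1}(pmf_sum1 pP) -(pmf_sum1 rP) -sumrB; apply: ler_sum => t _.
have [->|pt] := eqVneq (p t) 0; first by rewrite mul0r sub0r oppr_le0 pmf_ge0.
have p0 : 0 < p t by rewrite lt_def pt pmf_ge0.
have r0 : 0 < r t by rewrite lt_def pmf_ge0 // andbT; apply: contra_neq pt => /abs_cont.
have := @le_ln1Dx R (r t / p t - 1) ltac:(by rewrite ltrBDl addrN divr_gt0).
rewrite addrC subrK -invf_div lnV ?posrE ?divr_gt0 // => /(ler_wpM2l (ltW p0)).
by rewrite invf_div mulrBr mulr1 mulrCA divff // mulr1 mulrN; lra.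
Qed.

Lemma kl_div_le_inv (R : realType) (T : finType) (p r : T -> R) (c : R) :
  is_pmf p -> 0 < c -> (forall t, c * p t <= r t) -> kl_div p r <= c^-1.
Proof.
move=> pP c0 pr; rewrite -(expect_cst pP c^-1); apply: ler_sum => t _.
have [->|pt] := eqVneq (p t) 0; first by rewrite !mul0r.
have p0 : 0 < p t by rewrite lt_def pt pmf_ge0.
have r0 : 0 < r t by apply: lt_le_trans (pr t); rewrite mulr_gt0.
rewrite ler_pM2l //; apply: le_trans (ltW (ln_sublinear (divr_gt0 p0 r0))) _.
by rewrite ler_pdivrMr // ler_pdivlMl // mulrC in pr *.
Qed.

Section InformationDensity.
Variables (R : realType) (J K : nat) (P : 'I_J -> R) (U : 'I_J -> 'I_K -> R).

Definition output_law (b : 'I_K) : R := \sum_a P a * U a b.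

Definition info_nats : R := expect P (fun a => kl_div (U a) output_law).

Lemma info_natsE : info_nats = mutual_info P U * ln 2.
Proof.
have ln2 : ln 2 != 0 :> R by rewrite gt_eqF // ln_gt0 // ltr1n.
rewrite mulr_suml; apply: eq_bigr => a _; rewrite mulr_suml mulr_sumr.
apply: eq_bigr => b _; rewrite mulrA; case: ifP => [/eqP->|_]; first by rewrite !mul0r.
by rewrite -[RHS]mulrA divfK.
Qed.

Hypotheses (P_pmf : is_pmf P) (U_pmf : is_cond_pmf U).

Lemma output_law_pmf : is_pmf output_law.
Proof.
split=> [b|]; first by apply: sumr_ge0 => a _; rewrite mulr_ge0 ?(pmf_ge0 P_pmf) ?pmf_ge0.
rewrite exchange_big -(pmf_sum1 P_pmf); apply: eq_bigr => a _.
by rewrite -mulr_sumr (pmf_sum1 (U_pmf a)) mulr1.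
Qed.

Lemma term_le_output_law a b : P a * U a b <= output_law b.
Proof.
apply: (@term_le_sum _ _ (fun a' => P a' * U a' b)) => a'.
by rewrite mulr_ge0 ?(pmf_ge0 P_pmf) ?pmf_ge0.
Qed.

Lemma info_nats_ge0 : 0 <= info_nats.
Proof.
apply: sumr_ge0 => a _; have [->|Pa] := eqVneq (P a) 0; first by rewrite mul0r.
rewrite mulr_ge0 ?(pmf_ge0 P_pmf) // kl_div_ge0 // => [|b ob]; first exact: output_law_pmf.
have := term_le_output_law a b; rewrite ob pmulr_rle0 => [Ub|].
  by apply/eqP; rewrite eq_le Ub pmf_ge0.
by rewrite lt_def Pa (pmf_ge0 P_pmf).
Qed.

Lemma info_nats_le_card : info_nats <= J%:R.
Proof.
rewrite -[J]card_ord -sum1_card natr_sum; apply: ler_sum => a _.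
have [->|Pa] := eqVneq (P a) 0; first by rewrite mul0r.
have P0 : 0 < P a by rewrite lt_def Pa (pmf_ge0 P_pmf).
by rewrite -ler_pdivlMl // mulr1 kl_div_le_inv // => b; exact: term_le_output_law.
Qed.

Definition off_support (a : 'I_J) : option 'I_J := if P a == 0 then Some a else None.

(* The total weight [1 + J t] of the reference measure pays for the number of
   patterns of letters outside the support of [P]. *)
Definition ref_weight (t : R) (o : option 'I_J) (b : 'I_K) : R :=
  if o is Some a then t * U a b else output_law b.

Definition info_density (t : R) (a : 'I_J) (b : 'I_K) : R :=
  if P a == 0 then - ln t else ln (U a b / output_law b).

Lemma expect_info_density t :
  expect P (fun a => expect (U a) (info_density t a)) = info_nats.
Proof.
apply: eq_bigr => a _; have [->|Pa] := eqVneq (P a) 0; first by rewrite !mul0r.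
by congr (_ * _); apply: eq_bigr => b _; rewrite /info_density (negbTE Pa).
Qed.

Section ReferenceWeight.
Variable t : R.
Hypothesis t_gt0 : 0 < t.

Lemma ref_weight_ge0 o b : 0 <= ref_weight t o b.
Proof.
by case: o => [a|] /=; [rewrite mulr_ge0 ?(ltW t_gt0) ?pmf_ge0|exact: (pmf_ge0 output_law_pmf)].
Qed.

Lemma le_info_density_ref_weight a b :
  U a b <= expR (info_density t a b) * ref_weight t (off_support a) b.
Proof.
have [->|Uab] := eqVneq (U a b) 0; first by rewrite mulr_ge0 ?expR_ge0 ?ref_weight_ge0.
have U0 : 0 < U a b by rewrite lt_def Uab pmf_ge0.
rewrite /info_density /off_support; case: ifPn => Pa /=.
  by rewrite expRN lnK ?posrE // mulKf // gt_eqF.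
have o0 : 0 < output_law b.
  by apply: lt_le_trans (term_le_output_law a b); rewrite mulr_gt0 // lt_def Pa pmf_ge0.
by rewrite lnK ?posrE ?divr_gt0 // divfK // gt_eqF.
Qed.

Lemma chan_n_le_info_density n (x : {ffun 'I_n -> 'I_J}) (y : {ffun 'I_n -> 'I_K}) :
  chan_n U x y <= expR (coord_sum (fun i => info_density t (x i)) y) *
                  prod_law (fun i => ref_weight t (off_support (x i))) y.
Proof.
rewrite /coord_sum /prod_law expR_sum -big_split; apply: ler_prod => i _.
by rewrite pmf_ge0 //= le_info_density_ref_weight.
Qed.

Lemma sum_ref_weight : \sum_b \sum_o ref_weight t o b = 1 + J%:R * t.
Proof.
rewrite exchange_big (bigD1 None) //= (pmf_sum1 output_law_pmf); congr (_ + _).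
rewrite (reindex_omap Some id) /= => [|[]//].
under eq_bigr do rewrite -mulr_sumr (pmf_sum1 (U_pmf _)) mulr1.
rewrite (eq_bigl predT) => [|a]; last by rewrite eqxx.
by rewrite sumr_const card_ord mulr_natl.
Qed.

Lemma sum_prod_ref_weight n :
  \sum_(y : {ffun 'I_n -> 'I_K}) \sum_(s : {ffun 'I_n -> option 'I_J})
    prod_law (fun i => ref_weight t (s i)) y = (1 + J%:R * t) ^+ n.
Proof.
under eq_bigr do rewrite -(bigA_distr_bigA (fun i o => ref_weight t o (_ i))).
rewrite -(bigA_distr_bigA (fun i b => \sum_o ref_weight t o b)) /=.
by rewrite prodr_const card_ord sum_ref_weight.
Qed.

End ReferenceWeight.
End InformationDensity.

Lemma chan_n_pmf (R : realType) (J K n : nat) (U : 'I_J -> 'I_K -> R) (x : {ffun 'I_n -> 'I_J}) :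
  is_cond_pmf U -> is_pmf (chan_n U x).
Proof. by move=> UP; exact: (@prod_law_pmf _ _ _ (fun i => U (x i))). Qed.

(** * Codewords with the same joint type with the auxiliary output *)

Definition collides {I T : finType} (A : {set I}) (f : I -> T) (i : I) : bool :=
  [exists j in A, (j != i) && (f i == f j)].

Lemma sum_noncolliding_le (R : realType) (I T : finType) (A : {set I}) (f : I -> T)
    (F : T -> R) :
  (forall t, 0 <= F t) -> \sum_(i in A | ~~ collides A f i) F (f i) <= \sum_t F t.
Proof.
move=> F0; rewrite -big_set -(big_imset F) /= => [|i j].
  by rewrite [leRHS](bigID (mem (f @: [set i in A | ~~ collides A f i]))) /= lerDl sumr_ge0.
rewrite !inE => /andP[_ /existsPn/(_ j)] + /andP[jA _] fij.
by rewrite jA fij eqxx andbT negbK => /eqP.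
Qed.

(* Letters outside the support of [P], on which [M_max] imposes no condition, are
   recorded position by position, so that codewords in the same class agree there. *)
Definition joint_class {R : realType} {J K n : nat} (P : 'I_J -> R)
    (x : {ffun 'I_n -> 'I_J}) (y : {ffun 'I_n -> 'I_K}) :
    {ffun 'I_n -> option 'I_J} * {ffun 'I_J * 'I_K -> 'I_n.+1} :=
  ([ffun i => off_support P (x i)], [ffun ab => inord (occ (fun i => (x i, y i)) ab)]).

Lemma joint_class_eq (R : realType) (J K n : nat) (P : 'I_J -> R)
    (x x' : {ffun 'I_n -> 'I_J}) (y : {ffun 'I_n -> 'I_K}) :
  joint_class P x y = joint_class P x' y ->
  (forall i, P (x i) = 0 -> x i = x' i) /\
  occ (fun i => (x i, y i)) =1 occ (fun i => (x' i, y i)).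
Proof.
move=> [/ffunP same_rare /ffunP same_occ]; split=> [i Pi|ab].
  have := same_rare i; rewrite !ffunE /off_support Pi eqxx.
  by case: ifP => // _ [].
have occ_lt z : (occ (fun i : 'I_n => (z i, y i)) ab < n.+1)%N.
  by rewrite ltnS -[leqRHS]card_ord occ_le_card.
by have := same_occ ab; rewrite !ffunE => /(congr1 val); rewrite /= !inordK.
Qed.

Definition confusable {R : realType} {J K n M : nat} (P : 'I_J -> R) (C : codebook J n M)
    (A : {set 'I_M}) (y : {ffun 'I_n -> 'I_K}) : pred 'I_M :=
  collides A (fun m => joint_class P (C m) y).

Section ConfusableMass.
Variables (R : realType) (J K : nat) (P : 'I_J -> R) (U : 'I_J -> 'I_K -> R).
Hypotheses (P_pmf : is_pmf P) (U_pmf : is_cond_pmf U).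

Lemma sum_joint_class_ref_weight (t : R) (n : nat) :
  \sum_(y : {ffun 'I_n -> 'I_K})
    \sum_(k : {ffun 'I_n -> option 'I_J} * {ffun 'I_J * 'I_K -> 'I_n.+1})
      prod_law (fun i => ref_weight P U t (k.1 i)) y =
  n.+1%:R ^+ (J * K) * (1 + J%:R * t) ^+ n.
Proof.
rewrite -(sum_prod_ref_weight P_pmf U_pmf) mulr_sumr; apply: eq_bigr => y _.
rewrite -(pair_bigA _ (fun (s : {ffun 'I_n -> option 'I_J}) _ =>
  prod_law (fun i => ref_weight P U t (s i)) y)) /=.
rewrite mulr_sumr; apply: eq_bigr => s _.
by rewrite sumr_const card_ffun card_prod !card_ord -[LHS]mulr_natl natrX.
Qed.

(* For fixed [y] a joint class contains at most one non-confusable codeword, and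
   [ref_weight] bounds the likelihood by a function of the class. *)
Lemma nonconfusable_mass_le (t L : R) (n M : nat) (C : codebook J n M) (A : {set 'I_M}) :
  0 < t ->
  \sum_(m in A) prob (chan_n U (C m)) (fun y => ~~ confusable P C A y m &&
    (coord_sum (fun i => info_density P U t (C m i)) y <= L)) <=
  expR L * (n.+1%:R ^+ (J * K) * (1 + J%:R * t) ^+ n).
Proof.
move=> t0; rewrite -sum_joint_class_ref_weight mulr_sumr.
rewrite (exchange_big_dep predT) //=; apply: ler_sum => y _.
pose F (k : {ffun 'I_n -> option 'I_J} * {ffun 'I_J * 'I_K -> 'I_n.+1}) :=
  prod_law (fun i => ref_weight P U t (k.1 i)) y.
have F0 k : 0 <= F k by apply: prodr_ge0 => i _; exact: ref_weight_ge0.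
apply: le_trans (_ : expR L * \sum_(m in A | ~~ confusable P C A y m)
    F (joint_class P (C m) y) <= _).
  rewrite mulr_sumr !big_mkcondr /=; apply: ler_sum => m _.
  case: (confusable _ _ _ _ _) => //=; case: ifPn => [low|_]; last first.
    by rewrite mulr_ge0 ?expR_ge0.
  apply: le_trans (chan_n_le_info_density P_pmf U_pmf t0 (C m) y) _.
  rewrite [X in _ * X](_ : _ = F (joint_class P (C m) y)); last first.
    by apply: eq_bigr => i _; rewrite ffunE.
  by rewrite ler_wpM2r ?ler_expR.
by rewrite ler_wpM2l ?expR_ge0 ?sum_noncolliding_le.
Qed.

Lemma nonconfusable_mass_le_near (t delta L : R) :
  0 < t -> 0 < delta -> J%:R * t <= delta ->
  \forall n \near \oo, forall M (C : codebook J n M) (A : {set 'I_M}),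
    \sum_(m in A) prob (chan_n U (C m)) (fun y => ~~ confusable P C A y m &&
      (coord_sum (fun i => info_density P U t (C m i)) y <= n%:R * L)) <=
    expR (n%:R * (L + delta + delta)) / 4.
Proof.
move=> t0 d0 Jt; near=> n; move=> M C A.
apply: le_trans (nonconfusable_mass_le _ _ _ t0) _.
rewrite !mulrDr !expRD -!mulrA ler_wpM2l ?expR_ge0 // [leRHS]mulrC.
have Jt0 : 0 <= 1 + J%:R * t by rewrite addr_ge0 ?mulr_ge0 ?(ltW t0).
apply: ler_pM; rewrite ?exprn_ge0 //.
  rewrite ler_pdivlMr // mulrC; near: n.
  exact: poly_le_expR_near.
rewrite expRM_natl lerXn2r ?nnegrE ?expR_ge0 //.
by apply: le_trans (expR_ge1Dx _); rewrite lerD2l.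
Unshelve. all: by end_near.
Qed.

Lemma confusable_mass_ge (rho : R) : info_nats P U < rho ->
  exists2 eta, 0 < eta & \forall n \near \oo,
    forall M (C : codebook J n M) (A : {set 'I_M}),
      (forall m, m \in A -> typical P eta (C m)) ->
      expR (n%:R * rho) <= #|A|%:R ->
      #|A|%:R / 2 <=
        \sum_(m in A) prob (chan_n U (C m)) (fun y => confusable P C A y m).
Proof.
move=> info_lt; pose delta := (rho - info_nats P U) / 3.
have d0 : 0 < delta by rewrite divr_gt0 ?subr_gt0.
pose t := delta / J.+1%:R; have t0 : 0 < t by rewrite divr_gt0.
have Jt : J%:R * t <= delta by rewrite mulrA ler_pdivrMr // mulrC ler_pM2l ?ler_nat.
have [eta eta0 wlln] := @typical_wlln R _ _ P U (info_density P U t) delta 4^-1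
  U_pmf d0 ltac:(by rewrite invr_gt0).
exists eta => //; near=> n; move=> M C A A_typ A_large.
pose low m (y : {ffun 'I_n -> 'I_K}) :=
  coord_sum (fun i => info_density P U t (C m i)) y <= n%:R * (info_nats P U + delta).
have nonconfusable_low : \sum_(m in A) prob (chan_n U (C m))
    (fun y => ~~ confusable P C A y m && low m y) <= #|A|%:R / 4.
  apply: le_trans (_ : expR (n%:R * rho) / 4 <= _); last by rewrite ler_pM2r ?invr_gt0.
  have -> : rho = info_nats P U + delta + delta + delta by rewrite /delta; field.
  by move: M C A {A_typ A_large} @low; near: n; exact: nonconfusable_mass_le_near.
have high m : m \in A -> prob (chan_n U (C m)) (fun y => ~~ low m y) <= 4^-1.
  move=> mA; rewrite /prob; under eq_bigl do rewrite /low -ltNge.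
  rewrite -(expect_info_density P U t).
  by move: (C m) (A_typ m mA); near: n.
have mass m : m \in A -> 4^-1 + 2^-1 <= prob (chan_n U (C m)) (confusable P C A ^~ m) +
    prob (chan_n U (C m)) (fun y => ~~ confusable P C A y m && low m y).
  move=> /high high_m; have chanP := chan_n_pmf (C m) U_pmf.
  rewrite (prob_compl chanP (confusable P C A ^~ m)).
  suff : prob (chan_n U (C m)) (predC (confusable P C A ^~ m)) <=
      prob (chan_n U (C m)) (fun y => ~~ confusable P C A y m && low m y) +
      prob (chan_n U (C m)) (fun y => ~~ low m y) by lra.
  by apply: prob_le_add => // y /= ->; case: (low m y).
have : \sum_(m in A) (4^-1 + 2^-1) <= \sum_(m in A) prob (chan_n U (C m)) (confusable P C A ^~ m) +
    \sum_(m in A) prob (chan_n U (C m)) (fun y => ~~ confusable P C A y m && low m y).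
  by rewrite -big_split /=; apply: ler_sum => m; exact: mass.
rewrite sumr_const -[_ *+ #|A|]mulr_natl; lra.
Unshelve. all: by end_near.
Qed.

End ConfusableMass.

(** * Decoding errors *)

Definition decoding_error {R : realType} {J K n M : nat} (q : 'I_J -> 'I_K -> R)
    (C : codebook J n M) (m : 'I_M) : pred {ffun 'I_n -> 'I_K} := fun y =>
  [exists m' : 'I_M, (m' != m) && (metric_n q (C m) y <= metric_n q (C m') y)].

Section ErrorProbability.
Variables (R : realType) (J K : nat) (q W : 'I_J -> 'I_K -> R).
Hypothesis W_pmf : is_cond_pmf W.

Lemma err_probE n M (C : codebook J n M) :
  err_prob q W C = M%:R^-1 * \sum_m prob (chan_n W (C m)) (decoding_error q C m).
Proof. by congr (_ * _); apply: eq_bigr => m _; rewrite -big_mkcond. Qed.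

Lemma err_prob_ge0 n M (C : codebook J n M) : 0 <= err_prob q W C.
Proof.
rewrite err_probE mulr_ge0 ?invr_ge0 // sumr_ge0 // => m _.
by apply: prob_ge0; exact: chan_n_pmf.
Qed.

Lemma err_prob_le1 n M (C : codebook J n M) : err_prob q W C <= 1.
Proof.
case: M C => [|M] C; first by rewrite err_probE big_ord0 mulr0.
rewrite err_probE ler_pdivrMl ?ltr0n // mulr1 -[M.+1 in leRHS]card_ord -sumr_const.
by apply: ler_sum => m _; apply: prob_le1; exact: chan_n_pmf.
Qed.

Lemma err_prob_ge_subcode n M (C : codebook J n M) (A : {set 'I_M}) (c N : R) :
  (0 < M)%N -> 0 <= c -> 0 < N -> M%:R <= N * #|A|%:R ->
  c * #|A|%:R <= \sum_(m in A) prob (chan_n W (C m)) (decoding_error q C m) ->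
  c / N <= err_prob q W C.
Proof.
move=> M0 c0 N0 M_le A_error; rewrite err_probE ler_pdivlMl ?ltr0n // mulrCA.
apply: le_trans (_ : c * #|A|%:R <= _).
  by rewrite ler_wpM2l // ler_pdivrMr // mulrC.
apply: le_trans A_error _; rewrite [leRHS](bigID (mem A)) /= lerDl.
by apply: sumr_ge0 => m _; apply: prob_ge0; exact: chan_n_pmf.
Qed.

End ErrorProbability.

Definition typical_subcode_error_ge {R : realType} {J K : nat} (q W : 'I_J -> 'I_K -> R)
    (rho : R) (P : 'I_J -> R) (eta c : R) (n : nat) : Prop :=
  forall M (C : codebook J n M) (A : {set 'I_M}),
    (forall m, m \in A -> typical P eta (C m)) ->
    expR (n%:R * rho) <= #|A|%:R ->
    c * #|A|%:R <= \sum_(m in A) prob (chan_n W (C m)) (decoding_error q C m).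

Section MaximalChannelError.
Variables (R : realType) (J K : nat) (q : 'I_J -> 'I_K -> R).
Variables (P : 'I_J -> R) (V : 'I_J -> 'I_K * 'I_K -> R).
Hypotheses (P_pmf : is_pmf P) (V_max : M_max q P V).

Let V_pmf : is_cond_pmf V. Proof. by case: V_max. Qed.

Lemma prob_chan_n_posterior n (x : {ffun 'I_n -> 'I_J}) (A : pred {ffun 'I_n -> 'I_K}) :
  prob (chan_n (margY V) x) A =
  \sum_yh chan_n (margYhat V) x yh * prob (prod_law (fun i => posterior V (x i) (yh i))) A.
Proof.
under [RHS]eq_bigr do rewrite mulr_sumr.
rewrite exchange_big; apply: eq_bigr => y _.
rewrite /chan_n (bigA_distr_bigA (fun i b => V (x i) (y i, b))).
apply: eq_bigr => yh _; rewrite mulrC -big_split /=.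
by apply: eq_bigr => i _; rewrite posteriorK.
Qed.

Lemma decoding_error_ge_confusable :
  exists2 c, 0 < c & forall n M (C : codebook J n M) (A : {set 'I_M}) (m : 'I_M),
    c * prob (chan_n (margYhat V) (C m)) (fun yh => confusable P C A yh m) <=
    prob (chan_n (margY V) (C m)) (decoding_error q C m).
Proof.
have [c c0 overtaking] := overtaking_prob_lbound q V_pmf.
exists c => // n M C A m; rewrite prob_chan_n_posterior /prob big_mkcond mulr_sumr.
have margV := margYhat_pmf V_pmf.
apply: ler_sum => yh _; have chan0 := pmf_ge0 (chan_n_pmf (C m) margV) yh.
have [pos|] := boolP [forall i, 0 < margYhat V (C m i) (yh i)]; last first.
  rewrite negb_forall => /existsP[i]; rewrite lt_def pmf_ge0 // andbT negbK => /eqP Vi.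
  by rewrite /chan_n (bigD1 i) //= Vi !mul0r if_same mulr0.
have {}pos i : 0 < margYhat V (C m i) (yh i) by exact: (forallP pos).
have postP : is_cond_pmf (fun i => posterior V (C m i) (yh i)).
  by move=> i; exact: posterior_pmf.
case: ifPn => [/existsP[m' /and3P[_ m'm /eqP/joint_class_eq[rare same_occ]]]|_]; last first.
  by rewrite mulr0 mulr_ge0 //; exact: prob_ge0 (prod_law_pmf postP) _.
rewrite mulrC ler_wpM2l //.
apply: le_trans (overtaking _ _ (C m') _ pos _) _.
  exact: M_max_drift_ge0 pos rare same_occ.
apply: prob_mono => [|y better]; first exact: prod_law_pmf.
by apply/existsP; exists m'; rewrite m'm.
Qed.

Lemma exists_typical_subcode_error_ge (rho : R) : info_nats P (margYhat V) < rho ->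
  exists eta c : R, [/\ 0 < eta, 0 < c &
    \forall n \near \oo, typical_subcode_error_ge q (margY V) rho P eta c n].
Proof.
move=> info_lt.
have [eta eta0 many] := confusable_mass_ge P_pmf (margYhat_pmf V_pmf) info_lt.
have [c c0 error_ge] := decoding_error_ge_confusable.
exists eta, (c / 2); split; rewrite ?divr_gt0 //.
apply: filterS many => n many M C A A_typ A_large.
apply: le_trans (_ : c * (#|A|%:R / 2) <= _); first by rewrite mulrAC mulrA.
apply: le_trans (ler_wpM2l (ltW c0) (many M C A A_typ A_large)) _.
by rewrite mulr_sumr; apply: ler_sum.
Qed.

End MaximalChannelError.

(** * The value of the bound *)

Definition diag_channel {R : realType} {J K : nat} (W : 'I_J -> 'I_K -> R)
    (a : 'I_J) (y : 'I_K * 'I_K) : R := (y.1 == y.2)%:R * W a y.1.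

Arguments diag_channel : simpl never.

Definition auxiliary_infos {R : realType} {J K : nat} (W q : 'I_J -> 'I_K -> R)
    (P : 'I_J -> R) : set R :=
  [set mutual_info P (margYhat V) | V in [set V | M_max q P V /\ margY V = W]].

Section BoundValue.
Variables (R : realType) (J K : nat) (W q : 'I_J -> 'I_K -> R).
Hypothesis W_pmf : is_cond_pmf W.

Lemma margY_diag : margY (diag_channel W) = W.
Proof. by apply/funext => a; apply/funext => b; rewrite /margY sum_delta. Qed.

Lemma M_max_diag (P : 'I_J -> R) : M_max q P (diag_channel W).
Proof.
split=> [a|U UP marg].
  split=> [y|]; first by rewrite mulr_ge0 ?ler0n ?pmf_ge0.
  rewrite -(pmf_sum1 (W_pmf a)) -{2}margY_diag /margY pair_bigA /=.
  by apply: eq_bigr => -[].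
have swap (a x : 'I_J) y b : diag_channel W a (y, b) * q x y = diag_channel W a (y, b) * q x b.
  by rewrite /diag_channel /=; case: eqP => [->//|_]; rewrite !mul0r.
rewrite le_eqVlt; apply/orP; left; apply/eqP.
transitivity (\sum_b \sum_c (\sum_y P c * diag_channel W c (y, b)) * q c b).
  rewrite [RHS]exchange_big /=; apply: eq_bigr => a _.
  rewrite exchange_big /=; apply: eq_bigr => b _.
  by rewrite mulr_suml; apply: eq_bigr => y _; rewrite -mulrA swap mulrA.
under eq_bigr do under eq_bigr do rewrite -marg mulr_suml.
under eq_bigr do rewrite exchange_big /=.
rewrite exchange_big /=; apply: eq_bigr => a _.
rewrite [RHS]exchange_big /=; apply: eq_bigr => b _.
under eq_bigr do rewrite mulr_suml.
rewrite exchange_big /=; apply: eq_bigr => y _; apply: eq_bigr => c _.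
transitivity (diag_channel W a (y, b) * q c b * (P a * U a b c)); first by ring.
by rewrite -swap; ring.
Qed.

Variable P : 'I_J -> R.
Hypothesis P_pmf : is_pmf P.

Lemma auxiliary_infos_diag :
  auxiliary_infos W q P (mutual_info P (margYhat (diag_channel W))).
Proof. by exists (diag_channel W) => //; split; [exact: M_max_diag|exact: margY_diag]. Qed.

Lemma auxiliary_infos_ge0 : lbound (auxiliary_infos W q P) 0.
Proof.
move=> _ [V [[V_pmf _] _] <-]; rewrite -(@pmulr_lge0 _ (ln 2)) ?ln_gt0 ?ltr1n //.
by rewrite -info_natsE info_nats_ge0 //; exact: margYhat_pmf.
Qed.

Lemma has_inf_auxiliary_infos : has_inf (auxiliary_infos W q P).
Proof.
split; [exists (mutual_info P (margYhat (diag_channel W)))|exists 0].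
  exact: auxiliary_infos_diag.
exact: auxiliary_infos_ge0.
Qed.

Lemma inf_auxiliary_infos_le : inf (auxiliary_infos W q P) <= J%:R / ln 2.
Proof.
apply: le_trans (ge_inf has_inf_auxiliary_infos.2 auxiliary_infos_diag) _.
rewrite ler_pdivlMr ?ln_gt0 ?ltr1n // -info_natsE info_nats_le_card //.
by apply: margYhat_pmf; case: (M_max_diag P).
Qed.

End BoundValue.

Section RbarBounds.
Variables (R : realType) (J K : nat) (W q : 'I_J -> 'I_K -> R).
Hypothesis W_pmf : is_cond_pmf W.

Lemma inf_auxiliary_infos_le_Rbar (P : 'I_J -> R) :
  is_pmf P -> inf (auxiliary_infos W q P) <= Rbar W q.
Proof.
move=> P_pmf; apply: ub_le_sup; last by exists P.
by exists (J%:R / ln 2) => _ [P' P'_pmf <-]; exact: inf_auxiliary_infos_le.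
Qed.

Lemma Rbar_ge0 : 0 <= Rbar W q.
Proof.
have [[P P_pmf]|no_pmf] := pselect (exists P : 'I_J -> R, is_pmf P).
  apply: le_trans (inf_auxiliary_infos_le_Rbar P_pmf).
  by apply: lb_le_inf; [case: (has_inf_auxiliary_infos q W_pmf P_pmf)|exact: auxiliary_infos_ge0].
rewrite /Rbar (_ : [set P | is_pmf P] = set0) ?image_set0 ?sup0 //.
by apply/seteqP; split=> // P P_pmf; apply: no_pmf; exists P.
Qed.

Lemma exists_auxiliary_channel (P : 'I_J -> R) (rho : R) : is_pmf P -> Rbar W q < rho ->
  exists V, [/\ M_max q P V, margY V = W & info_nats P (margYhat V) < rho * ln 2].
Proof.
move=> P_pmf Rbar_lt.
have [infos_ne _] := has_inf_auxiliary_infos q W_pmf P_pmf.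
have [_ [V [VM VW] <-] V_lt] :=
  inf_lt infos_ne (le_lt_trans (inf_auxiliary_infos_le_Rbar P_pmf) Rbar_lt).
by exists V; split; rewrite // info_natsE ltr_pM2r ?ln_gt0 ?ltr1n.
Qed.

End RbarBounds.

(** * Covering the compositions *)

Definition simplex (R : realType) (J : nat) : set 'rV[R]_J :=
  [set v : 'rV[R]_J | is_pmf (v ord0)].

Lemma simplex_compact (R : realType) (J : nat) : compact (@simplex R J).
Proof.
pose cube : set 'rV[R]_J := [set v : 'rV[R]_J | forall a, `[0%R, 1%R]%classic (v ord0 a)].
have cube_compact : compact cube.
  by apply: (@rV_compact _ _ (fun=> `[0%R : R, 1%R]%classic)) => a; exact: segment_compact.
have -> : @simplex R J = cube `&` [set v : 'rV[R]_J | \sum_a v ord0 a = 1].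
  apply/seteqP; split=> v /=.
    move=> [v0 v1]; split=> // a; rewrite /= in_itv /= v0 -v1 /=.
    exact: term_le_sum.
  by move=> [v_cube v1]; split=> // a; have /= := v_cube a; rewrite in_itv /= => /andP[].
apply: compact_closedI => //.
apply: (@preimage_closed _ _ (fun v : 'rV[R]_J => \sum_a v ord0 a) [set x | x = 1]).
  move=> v _; apply: continuous_big => [|a _]; first exact: add_continuous.
  exact: coord_continuous.
exact: closed_eq.
Qed.

Lemma simplex_cover (R : realType) (J : nat) (r : ('I_J -> R) -> R) :
  (forall p, is_pmf p -> 0 < r p) ->
  exists (I : finType) (P : I -> 'I_J -> R), is_cond_pmf P /\
    forall p, is_pmf p -> exists i, forall a, `|p a - P i a| <= r (P i).
Proof.
move=> r0; have := @simplex_compact R J; rewrite compact_cover.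
move=> /(_ _ (@simplex R J) (fun v => interior (ball v (r (v ord0))))).
case=> [v _|v v_pmf|D D_pmf D_cover]; first exact: open_interior.
  by exists v => //; exact: nbhsx_ballx (r0 _ v_pmf).
exists (fset_sub_type D : finType), (fun v : fset_sub_type D => fsval v ord0); split=> [v|p p_pmf].
  by have := D_pmf _ (valP v); rewrite inE.
have [|v vD /interior_subset[_ near_v]] := D_cover (\row_a p a).
  by rewrite /simplex /= (_ : (\row_a p a) ord0 = p) //; apply/funext => a; rewrite mxE.
exists [` vD]%fset => a /=.
by have := near_v ord0 a; rewrite mxE /ball /= distrC => /ltW.
Qed.

Lemma empirical_pmf (R : realType) (S : finType) (n : nat) (x : {ffun 'I_n -> S}) :
  (0 < n)%N -> is_pmf (fun s => (occ x s)%:R / n%:R : R).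
Proof.
move=> n0; split=> [s|]; first by rewrite divr_ge0.
rewrite (sum_occ x (fun=> n%:R^-1)) sumr_const card_ord -[_ *+ n]mulr_natl divff //.
by rewrite pnatr_eq0 -lt0n.
Qed.

Lemma typical_cover (R : realType) (J : nat) (eta : ('I_J -> R) -> R) :
  (forall p, is_pmf p -> 0 < eta p) ->
  exists (I : finType) (P : I -> 'I_J -> R), is_cond_pmf P /\
    forall n (x : {ffun 'I_n -> 'I_J}), (0 < n)%N -> exists i, typical (P i) (eta (P i)) x.
Proof.
move=> /simplex_cover[I [P [P_pmf P_cover]]]; exists I, P; split=> // n x n0.
have [i near_i] := P_cover _ (empirical_pmf R x n0); exists i; apply/forallP => a.
have nR0 : 0 < n%:R :> R by rewrite ltr0n.
have -> : (occ x a)%:R - n%:R * P i a = n%:R * ((occ x a)%:R / n%:R - P i a).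
  by rewrite mulrBr mulrCA divff ?mulr1 // gt_eqF.
by rewrite normrM (ger0_norm (ltW nR0)) ler_pM2l.
Qed.

Lemma pigeonhole_cover (I T : finType) (A : I -> {set T}) :
  (forall t, exists i, t \in A i) -> (0 < #|T|)%N -> exists i, (#|T| <= #|I| * #|A i|)%N.
Proof.
move=> cov /card_gt0P[t0 _]; have [i0 _] := cov t0.
have [i _ i_max] := @arg_maxnP I i0 predT (fun i => #|A i|) isT.
exists i; rewrite -sum_nat_const; apply: leq_trans (leq_sum _ (fun j _ => i_max j isT)).
rewrite -sum1_card (eq_bigr (fun j => \sum_t (t \in A j)))%N => [|j _]; last first.
  by rewrite -sum1_card big_mkcond.
rewrite exchange_big; apply: leq_sum => t _.
by have [j tj] := cov t; rewrite (bigD1 j) //= tj.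
Qed.

(** * The upper bound *)

Lemma limn_inf_ge (R : realType) (u : nat -> R) (c : R) :
  has_ubound (range u) -> has_lbound (range u) ->
  (\forall n \near \oo, c <= u n) -> c <= limn_inf u.
Proof.
move=> u_ub u_lb [N _ cu]; apply: limr_ge; first exact: cvgP (cvg_infs_sup u_ub u_lb).
exists N => // n Nn; apply: lb_le_inf; first by exists (u n); exists n => /=.
by move=> _ [k /= nk <-]; apply: cu; exact: leq_trans nk.
Qed.

Section ErrorAboveRbar.
Variables (R : realType) (J K : nat) (W q : 'I_J -> 'I_K -> R).
Hypothesis W_pmf : is_cond_pmf W.

Lemma uniform_typical_subcode_error_ge (rho : R) : Rbar W q < rho ->
  exists (I : finType) (P : I -> 'I_J -> R) (eta : I -> R) (c : R), [/\ 0 < c,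
    \forall n \near \oo, forall i,
      typical_subcode_error_ge q W (rho * ln 2) (P i) (eta i) c n &
    forall n (x : {ffun 'I_n -> 'I_J}), (0 < n)%N -> exists i, typical (P i) (eta i) x].
Proof.
move=> Rbar_lt.
have /choice[f f_error] : forall P : 'I_J -> R, exists t : R * R, is_pmf P -> [/\ 0 < t.1,
    0 < t.2 & \forall n \near \oo, typical_subcode_error_ge q W (rho * ln 2) P t.1 t.2 n].
  move=> P; have [P_pmf|] := pselect (is_pmf P); last by exists (0, 0).
  have [V [VM VW]] := exists_auxiliary_channel W_pmf P_pmf Rbar_lt.
  move=> /(exists_typical_subcode_error_ge P_pmf VM)[eta [c]]; rewrite VW => error_ge.
  by exists (eta, c).
have [|I [P [P_pmf cover]]] := @typical_cover R J (fun p => (f p).1).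
  by move=> p /f_error[].
have [i|i ci0|c c0 c_le] := @exists_scale_le R I (fun=> 1) (fun i => (f (P i)).2).
- by have [_ /ltW] := f_error _ (P_pmf i).
- by have [_ + _] := f_error _ (P_pmf i); rewrite ci0 ltxx.
exists I, P, (fun i => (f (P i)).1), c; split=> //; apply: filter_forall => i.
have [_ _ error_ge] := f_error _ (P_pmf i).
apply: filterS error_ge => n error_ge M C A A_typ /(error_ge M C A A_typ).
by apply: le_trans; rewrite ler_wpM2r // -[c]mulr1.
Qed.

Lemma error_above_Rbar (rho : R) : Rbar W q < rho ->
  exists2 c, 0 < c & \forall n \near \oo, forall M (C : codebook J n M),
    2 `^ (n%:R * rho) <= M%:R -> c <= err_prob q W C.
Proof.
move=> Rbar_lt; pose e := (rho - Rbar W q) / 2.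
have e0 : 0 < e by rewrite divr_gt0 // subr_gt0.
have [|I [P [eta [c [c0 error_ge cover]]]]] := @uniform_typical_subcode_error_ge (rho - e).
  by rewrite /e; lra.
pose N : R := #|I|.+1%:R; have N0 : 0 < N by rewrite ltr0n.
exists (c / N); first by rewrite divr_gt0.
near=> n; move=> M C M_large.
have n0 : (0 < n)%N by near: n; exact: nbhs_infty_gt.
have M0 : (0 < M)%N by rewrite -(ltr0n R); apply: lt_le_trans M_large; rewrite powR_gt0.
pose A i : {set 'I_M} := [set m | typical (P i) (eta i) (C m)]%SET.
have [m||i] := @pigeonhole_cover I 'I_M A; rewrite ?card_ord //.
  by have [i typ_i] := cover n (C m) n0; exists i; rewrite inE.
rewrite -(ler_nat R) natrM => M_le.
have {}M_le : M%:R <= N * #|A i|%:R.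
  by apply: le_trans M_le _; rewrite ler_wpM2r // ler_nat.
apply: (err_prob_ge_subcode W_pmf M0 (ltW c0) N0 M_le).
have error_n : forall j, typical_subcode_error_ge q W ((rho - e) * ln 2) (P j) (eta j) c n.
  by near: n.
apply: (error_n i) => [m|]; first by rewrite inE.
rewrite -(ler_pM2l N0); apply: le_trans (le_trans M_large M_le).
have N_le : N <= expR (n%:R * (e * ln 2)).
  have : N / (e * ln 2) <= n%:R by near: n; exact: nbhs_infty_ger.
  rewrite ler_pdivrMr => [N_le|]; last by rewrite mulr_gt0 // ln_gt0 // ltr1n.
  by apply: le_trans (expR_ge1Dx _); rewrite ler_wpDl.
rewrite /powR pnatr_eq0 /= (_ : n%:R * rho * ln 2 =
  n%:R * (e * ln 2) + n%:R * ((rho - e) * ln 2)); last by ring.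
by rewrite expRD ler_wpM2r ?expR_ge0.
Unshelve. all: by end_near.
Qed.

End ErrorAboveRbar.

Theorem theorem1 (R : realType) (J K : nat)
  (W : 'I_J -> 'I_K -> R) (q : 'I_J -> 'I_K -> R) :
  is_cond_pmf W ->
  mismatch_capacity q W <= Rbar W q.
Proof.
move=> W_pmf; rewrite /mismatch_capacity.
have [->|/set0P nonempty] := eqVneq [set r | achievable q W r] set0.
  by rewrite sup0 Rbar_ge0.
apply: ge_sup nonempty _ => r [_ ach]; rewrite leNgt; apply/negP => Rbar_lt.
pose eps := (r - Rbar W q) / 2.
have [|M [C [M_large liminf0]]] := ach eps; first by rewrite divr_gt0 // subr_gt0.
have [|c c0 error_ge] := @error_above_Rbar _ _ _ W q W_pmf (r - eps); first by rewrite /eps; lra.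
suff : c <= 0 by rewrite leNgt c0.
rewrite -liminf0; apply: limn_inf_ge.
- by exists 1 => _ [n _ <-]; exact: err_prob_le1.
- by exists 0 => _ [n _ <-]; exact: err_prob_ge0.
- by apply: filterS error_ge => n; apply.
Qed.
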